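(* Let $\mu$ be an absolutely continuous Borel probability measure (with respect to Lebesgue measure) supported in $X$, and let $c$ satisfy: $c(\cdot,y_i)\in C^2(X)$ for every $i$, and $\nabla_x c(x,y_i)\ne\nabla_x c(x,y_k)$ for all $x\in X$ and $i\neq k$. Let $\lambda_1,\lambda_2\in\Lambda$ and let $\psi_1,\psi_2\in\mathbb{R}^N$ be optimal dual vectors for $\nu_{\lambda_1}$ and $\nu_{\lambda_2}$ respectively. Then $$\sum_{i=1}^N \Delta_\mu(\mathrm{Lag}_i(\psi_1),\mathrm{Lag}_i(\psi_2))\le 4N\|\lambda_1-\lambda_2\|_1 .$$
   Context: Fix integers $n\ge2$, $N\ge1$, a compact set $X\subset\mathbb{R}^n$, a finite set $Y=\{y_1,\dots,y_N\}\subset\mathbb{R}^n$ of $N$ points, and a Borel measurable cost $c:X\times Y\to\mathbb{R}$. Superscripts denote coordinates of vectors in $\mathbb{R}^N$; $\|V\|_1=\sum_i|V^i|$. $\Lambda=\{\lambda\in\mathbb{R}^N: \lambda^i\ge0,\ \sum_i\lambda^i=1\}$ and $\nu_\lambda=\sum_{i=1}^N\lambda^i\delta_{y_i}$. For $\psi\in\mathbb{R}^N$, $\psi^{c^*}(x)=\max_{i}(-c(x,y_i)-\psi^i)$ for $x\in X$, and the $i$th Laguerre cell is $\mathrm{Lag}_i(\psi)=\{x\in X: -c(x,y_i)-\psi^i=\psi^{c^*}(x)\}$. A vector $\psi\in\mathbb{R}^N$ is an optimal dual vector for $\nu_\lambda$ if the pair $(\psi^{c^*},\psi)$ attains $\max\{-\int_X\phi\,d\mu-\langle\psi,\lambda\rangle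 : (\phi,\psi)\in L^1(\mu)\times\mathbb{R}^N,\ -\phi(x)-\psi^i\le c(x,y_i)\ \text{for all } i \text{ and } \mu\text{-a.e. }x\in X\}$ (the Kantorovich dual of minimizing $\int_X c(x,T(x))\,d\mu$ over Borel $T:X\to Y$ with $T_\#\mu=\nu_\lambda$). For Borel sets $A,B$, $\Delta_\mu(A,B)=\mu((A\setminus B)\cup(B\setminus A))$. *)

(* Defs.v *)
From HB Require Import structures.
From mathcomp Require Import all_boot all_order all_algebra.
From mathcomp Require Import all_classical all_reals all_analysis.
From mathcomp Require Import measurable_realfun.

Set Implicit Arguments.
Unset Strict Implicit.
Unset Printing Implicit Defensive.

Import Order.TTheory GRing.Theory Num.Theory.
Import numFieldNormedType.Exports.

Local Open Scope classical_set_scope.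
Local Open Scope ring_scope.

(* R^n with its Borel sigma-algebra.  The carrier is ['rV[R]_n] up to          *)
(* conversion, but only ['rV[R]_n] carries the topology and only               *)
(* [borelRn R n] the sigma-algebra, hence the casts below.                      *)
Definition borelRn (R : realType) (n : nat) :=
  g_sigma_algebraType (@open 'rV[R]_n).
Section borel_vectors.
Context {R : realType}.

Lemma open_measurable_Rn n (U : set 'rV[R]_n) :
  open U -> measurable (U : set (borelRn R n)).
Proof. by move=> oU; exact: sub_sigma_algebra. Qed.

Lemma measurable_coord n (i : 'I_n) :
  measurable_fun [set: borelRn R n] (fun v : borelRn R n => v ord0 i : R).
Proof.
apply: (measurability _ (RGenOpens.measurableE R)).
move=> _ [_ [a [b ->]] <-]; rewrite setTI.
apply: open_measurable_Rn.
apply: (@open_comp _ _ (fun v : 'rV[R]_n => v ord0 i)) => //.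
by move=> v _; exact: coord_continuous.
Qed.

Lemma measurable_fun_Rn d (T : measurableType d) n (f : T -> borelRn R n) :
  (forall i, measurable_fun [set: T] (fun t => f t ord0 i : R)) ->
  measurable_fun [set: T] f.
Proof.
move=> mf; apply: (@measurability _ _ T (borelRn R n) setT f (@open 'rV[R]_n)) => //.
move=> _ [U oU <-]; rewrite setTI.
pose B (qk : 'rV[rat]_n * nat) : set 'rV[R]_n :=
  [set v | forall i, `|ratr (qk.1 ord0 i) - v ord0 i| < qk.2.+1%:R^-1].
have UE : U = \bigcup_(qk in [set qk | B qk `<=` U]) B qk.
  apply/seteqP; split => [v Uv|v [qk /= + Bv]]; last exact.
  have /nbhs_ballP[e /= e0 veU] : nbhs v U by exact: open_nbhs_nbhs.
  pose k := Num.truncn (2 / e).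
  have ke : 2 * k.+1%:R^-1 < e.
    rewrite ltr_pdivrMr// mulrC -ltr_pdivrMr//.
    exact: truncnS_gt.
  have Q i : exists q : rat, `|ratr q - v ord0 i| < k.+1%:R^-1.
    have : v ord0 i - k.+1%:R^-1 < v ord0 i + k.+1%:R^-1.
      by rewrite ltrBlDr -addrA ltrDl addr_gt0.
    move=> /rat_in_itvoo[q]; rewrite in_itv/= => /andP[q1 q2].
    by exists q; rewrite ltr_distl q1 q2.
  exists (\row_i projT1 (cid (Q i)), k) => /=.
    move=> w Bw; apply: veU; split => // i j; rewrite (ord1 i) /ball/=.
    have := Bw j; have := projT2 (cid (Q j)); rewrite /= mxE.
    set q := ratr _ => h1 h2.
    rewrite -(subrKA q) (le_lt_trans (ler_normD _ _))// (lt_trans _ ke)//.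
    by rewrite mulr_natl mulr2n ltrD// distrC.
  by move=> i /=; rewrite mxE; exact: (projT2 (cid (Q i))).
rewrite UE preimage_bigcup bigcup_mkcond.
apply: countable_bigcupT_measurable => [|qk]; first exact: countableP.
case: ifPn => // _.
rewrite [X in measurable X](_ : _ = \bigcap_(i in [set: 'I_n])
    (f @^-1` [set v | `|ratr (qk.1 ord0 i) - v ord0 i| < qk.2.+1%:R^-1])).
  apply: fin_bigcap_measurable => [|i _]; first exact: finite_finset.
  pose g t : R := f t ord0 i.
  rewrite [X in measurable X](_ : _ = g @^-1`
    `](ratr (qk.1 ord0 i) - qk.2.+1%:R^-1), (ratr (qk.1 ord0 i) + qk.2.+1%:R^-1)[%classic).
    by rewrite -[X in measurable X]setTI; apply: mf => //; exact: measurable_itv.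
  by apply/seteqP; split => t /=; rewrite in_itv/= distrC ltr_distl.
apply/seteqP; split => [t ht i _|t ht i]; first exact: ht.
  exact: ht.
Qed.

End borel_vectors.

(* Lebesgue measure on R^(n+1) as the product of the Lebesgue measure on the   *)
(* first coordinate with a measure [m] on the remaining n ones.                *)
Section lebesgue_Rn_step.
Context {R : realType} {n : nat}.
Variable m : {sigma_finite_measure set (borelRn R n) -> \bar R}.

Definition consRn (p : measurableTypeR R * borelRn R n) : borelRn R n.+1 :=
  row_mx (p.1 : R)%:M (p.2 : 'rV[R]_n).

Lemma consRn0 p : consRn p ord0 ord0 = p.1.
Proof.
have := row_mxEl ((p.1 : R)%:M : 'M[R]_1) (p.2 : 'rV[R]_n) ord0 ord0.
by rewrite [RHS]mxE eqxx mulr1n => <-; rewrite /consRn; congr (row_mx _ _ _ _); exact: val_inj.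
Qed.

Lemma consRnS p i : consRn p ord0 (lift ord0 i) = p.2 ord0 i.
Proof.
rewrite -(row_mxEr ((p.1 : R)%:M : 'M[R]_1) (p.2 : 'rV[R]_n)).
by rewrite /consRn; congr (row_mx _ _ _ _); exact: val_inj.
Qed.

Lemma measurable_consRn : measurable_fun setT consRn.
Proof.
apply: measurable_fun_Rn => i; have [j ->|->] := unliftP ord0 i.
  under eq_fun do rewrite consRnS.
  exact: (measurableT_comp (measurable_coord j) measurable_snd).
by under eq_fun do rewrite consRn0; exact: measurable_fst.
Qed.

Definition unconsRn (v : borelRn R n.+1) : measurableTypeR R * borelRn R n :=
  (v ord0 ord0, \row_i v ord0 (lift ord0 i)).

Lemma measurable_unconsRn : measurable_fun setT unconsRn.
Proof.
apply/measurable_fun_pairP; split; first exact: measurable_coord.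
apply: measurable_fun_Rn => i; rewrite /unconsRn/=.
by under eq_fun do rewrite mxE; exact: measurable_coord.
Qed.

Lemma consRnK : cancel consRn unconsRn.
Proof.
move=> [x v]; rewrite /unconsRn consRn0; congr pair.
by apply/rowP => i; rewrite mxE consRnS.
Qed.

Definition lebesgue_Rn_step : set (borelRn R n.+1) -> \bar R :=
  pushforward (lebesgue_measure \x m)%E consRn.

Let lebesgue_Rn_step0 : lebesgue_Rn_step set0 = 0%E.
Proof. by rewrite /lebesgue_Rn_step /pushforward preimage_set0 measure0. Qed.

Let lebesgue_Rn_step_ge0 A : (0 <= lebesgue_Rn_step A)%E.
Proof. rewrite /lebesgue_Rn_step /pushforward; exact: measure_ge0. Qed.

Let lebesgue_Rn_step_sigma_additive : semi_sigma_additive lebesgue_Rn_step.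
Proof.
pose P := measure_function_pushforward__canonical__measure_function_Measure
  (lebesgue_measure \x m)%E measurable_consRn.
exact: (@measure_semi_sigma_additive _ _ _ P).
Qed.

HB.instance Definition _ := isMeasure.Build _ _ _ lebesgue_Rn_step
  lebesgue_Rn_step0 lebesgue_Rn_step_ge0 lebesgue_Rn_step_sigma_additive.

Let lebesgue_Rn_step_sigma_finite : sigma_finite setT lebesgue_Rn_step.
Proof.
have /sigma_finiteP[F [FT ndF Foo]] := sigma_finiteT (@lebesgue_measure R).
have /sigma_finiteP[G [GT ndG Goo]] := sigma_finiteT m.
exists (fun k => unconsRn @^-1` (F k `*` G k)).
  apply/seteqP; split => // v _.
  have [k _ Fk] : (\bigcup_k F k) (unconsRn v).1 by rewrite -FT.
  have [l _ Gl] : (\bigcup_k G k) (unconsRn v).2 by rewrite -GT.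
  exists (maxn k l) => //; split.
    exact: (subsetPset _ _ (ndF _ _ (leq_maxl k l))) Fk.
  exact: (subsetPset _ _ (ndG _ _ (leq_maxr k l))) Gl.
move=> k; have [mF Fk] := Foo k; have [mG Gk] := Goo k; split.
  rewrite -[X in measurable X]setTI; apply: measurable_unconsRn => //.
  exact: measurableX.
rewrite /lebesgue_Rn_step /pushforward -comp_preimage.
rewrite (_ : _ \o _ = id); last by apply/funext => p /=; rewrite consRnK.
by rewrite preimage_id product_measure1E// lte_mul_pinfty// ge0_fin_numE.
Qed.

HB.instance Definition _ := Measure_isSigmaFinite.Build _ _ _
  lebesgue_Rn_step lebesgue_Rn_step_sigma_finite.

End lebesgue_Rn_step.

Fixpoint lebesgue_Rn (R : realType) (n : nat) :
    {sigma_finite_measure set (borelRn R n) -> \bar R} :=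
  match n with
  | 0 => \d_((0 : 'rV[R]_0) : borelRn R 0)
  | n'.+1 => lebesgue_Rn_step (lebesgue_Rn R n')
  end.

Lemma lebesgue_Rn_box (R : realType) (n : nat)
    (A : 'I_n -> set (measurableTypeR R)) :
  (forall i, measurable (A i)) ->
  lebesgue_Rn R n [set v | forall i, A i (v ord0 i)] =
    (\prod_(i < n) lebesgue_measure (A i))%E.
Proof.
elim: n A => [|n IHn] A mA.
  by rewrite big_ord0 /= diracE mem_set// => -[].
pose B : set (borelRn R n) := [set v | forall i, A (lift ord0 i) (v ord0 i)].
have mB : measurable B.
  rewrite (_ : B = \bigcap_(i in [set: 'I_n])
      ((fun v : borelRn R n => v ord0 i : R) @^-1` A (lift ord0 i))).
    apply: fin_bigcap_measurable => [|i _]; first exact: finite_finset.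
    by rewrite -[X in measurable X]setTI; apply: measurable_coord => //; exact: mA.
  by apply/seteqP; split => [v Bv i _|v Bv i]; exact: Bv.
rewrite big_ord_recl -IHn//= /lebesgue_Rn_step /pushforward.
rewrite -product_measure1E//; congr (_ _); apply/seteqP; split => -[x v] /=.
  move=> h; split=> [|i]; first by have := h ord0; rewrite consRn0.
  by have := h (lift ord0 i); rewrite consRnS.
move=> [h0 h] i; have [j ->|->] := unliftP ord0 i; last by rewrite consRn0.
by rewrite consRnS; exact: h.
Qed.

Section smooth_functions.
Context {R : realType} {n : nat}.
Implicit Types (f : 'rV[R]_n -> R) (U X : set 'rV[R]_n).

Definition gradient f (x : 'rV[R]_n) : 'rV[R]_n :=
  \row_j 'D_(delta_mx ord0 j) f x.

Definition C1_on U f := forall x, U x ->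
  differentiable f x /\ {for x, continuous (gradient f)}.

Definition C2_on U f :=
  C1_on U f /\ forall j, C1_on U (fun x => gradient f x ord0 j).

(* C^2 on a neighbourhood of [X], so that [gradient f] and the second          *)
(* derivatives make sense at every point of [X], whatever its boundary: a      *)
(* function given on [X] only is to be replaced by a C^2 extension.            *)
Definition C2_near X f := exists2 U, open U /\ X `<=` U & C2_on U f.

End smooth_functions.

Section semidiscrete_transport.
Context {R : realType} {n N : nat}.
Variable mu : probability (borelRn R n) R.
Variable X : set 'rV[R]_n.
Variable c : 'rV[R]_n -> 'rV[R]_n -> R.
Variable y : 'I_N -> 'rV[R]_n.
Implicit Types (phi : 'rV[R]_n -> R) (psi lambda : 'rV[R]_N) (x : 'rV[R]_n).

Definition l1norm (v : 'rV[R]_N) : R := \sum_(i < N) `|v ord0 i|.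

Definition simplex : set 'rV[R]_N :=
  [set lambda | (forall i, 0 <= lambda ord0 i) /\
                \sum_(i < N) lambda ord0 i = 1].

Definition borel_cost :=
  measurable_fun (X `*` range y : set (borelRn R n * borelRn R n)%type)
    (fun p : borelRn R n * borelRn R n => c p.1 p.2).

(* The supremum of a finite set, hence the maximum as soon as [0 < N].         *)
Definition cost_transform psi x : R :=
  sup (range (fun i : 'I_N => - c x (y i) - psi ord0 i)).

Definition laguerre psi (i : 'I_N) : set 'rV[R]_n :=
  [set x | X x /\ - c x (y i) - psi ord0 i = cost_transform psi x].

Definition dual_admissible phi psi :=
  mu.-integrable X (EFin \o phi) /\
  {ae mu, forall x, X x -> forall i, - phi x - psi ord0 i <= c x (y i)}.

Definition dual_value lambda phi psi : R :=
  - (\int[mu]_(x in X) phi x) - \sum_(i < N) psi ord0 i * lambda ord0 i.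

(* [psi] is an optimal dual vector for the target measure                      *)
(* [\sum_(i < N) lambda ord0 i * \d_(y i)].                                    *)
Definition optimal_dual_vector lambda psi :=
  dual_admissible (cost_transform psi) psi /\
  forall phi' psi', dual_admissible phi' psi' ->
    dual_value lambda phi' psi' <= dual_value lambda (cost_transform psi) psi.

Definition sym_diff_measure (A B : set 'rV[R]_n) : \bar R :=
  mu ((A `\` B) `|` (B `\` A)).

End semidiscrete_transport.

(* Main.v *)
Require Import Defs.
From mathcomp Require Import all_boot all_order all_algebra.
From mathcomp Require Import all_classical all_reals all_analysis.
From mathcomp Require Import measurable_realfun.
From mathcomp Require Import lra.

Import Order.TTheory GRing.Theory Num.Theory.
Import numFieldNormedType.Exports.

Local Open Scope classical_set_scope.
Local Open Scope ring_scope.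

(** Write [s_i(x) = - c(x, y_i) - psi^i] for the score of [y_i] at [x], so that
    the [i]th Laguerre cell is where [s_i] attains the maximum [psi^{c^*}].

    Ties are negligible.  Two scores agree on a level set of
    [c(., y_i) - c(., y_k)], whose gradient does not vanish on [X].  Where the
    [j]th partial derivative is nonzero, a line parallel to the [j]th axis meets
    the level set in isolated points only, hence in a countable set, so Fubini
    shows that this part is Lebesgue-null ([lebesgue_Rn_level_set],
    [ties_negligible]).

    Optimality gives [mu (Lag_i psi) <= lambda^i].  Let [G] be the set where the
    maximum exceeds every score other than [s_i] by at least [t > 0].  Raising
    [psi^i] by [t] and lowering the potential by [t] on [G] keeps the pair
    admissible and changes the dual value by [t * mu G - t * lambda^i], which
    cannot be positive; then [t] tends to 0 ([margin_set_le], [laguerre_le]).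
    As the cells cover [X] and the weights sum to 1, this inequality carries as
    much information as the mass balance [mu (Lag_i psi) = lambda^i].

    Finally put [d = psi1 - psi2].  A point which is not a tie and passes from
    the [i]th cell of [psi1] to the [j]th cell of [psi2] with [i <> j] satisfies
    [d^i < d^j] ([laguerre_trade]): mass only climbs along [d].  Cut the indices
    at level [d^k]: let [A] be the union of the cells of [psi1] below or at the
    level and [C] the union of the cells of [psi2] above it.  Up to a
    null set [A] and [C] cover [X], and the points leaving the [k]th cell lie in
    both, so their mass is at most [mu A + mu C - 1], that is at most the sum of
    [lambda1^i - lambda2^i] over the lower indices, which is at most
    [|lambda1 - lambda2|_1] ([laguerre_setD_le]).  Exchanging the roles of the
    two vectors bounds each symmetric difference by twice the norm, and the sum
    over [k] gives [2 * N] times the norm, within the stated constant. *)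

(** * Level sets and Lebesgue measure *)

(** Each point is alone in some interval with rational end points, and there are
    countably many of these. *)
Lemma countable_isolated (R : realType) (D : set R) :
  (forall s, D s -> \forall h \near 0^', ~ D (h + s)) -> countable D.
Proof.
move=> isoD.
pose I (pq : rat * rat) : set R := [set` `]ratr pq.1, ratr pq.2[].
pose one (pq : rat * rat) := forall a b, (D `&` I pq) a -> (D `&` I pq) b -> a = b.
have cI pq : countable [set s | one pq /\ (D `&` I pq) s].
  have [[a [onepq Da]]|no] := pselect (exists s, one pq /\ (D `&` I pq) s).
    apply: (@sub_countable _ _ _ [set a]); last exact: finite_set_countable.
    by apply: subset_card_le => b [_ Db]; exact: onepq.
  rewrite (_ : [set s | _] = set0) ?countable0//.
  by rewrite -subset0 => s ?; apply: no; exists s.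
apply: (@sub_countable _ _ _
    (\bigcup_(pq in [set: rat * rat]) [set s | one pq /\ (D `&` I pq) s])); last first.
  by apply: bigcup_countable => //; exact: countableP.
apply: subset_card_le => s Ds.
have /nbhs_ballP[e /= e0 De] := isoD _ Ds.
have [p] := @rat_in_itvoo _ (s - e) s (ltac:(lra)).
rewrite in_itv/= => /andP[p1 p2].
have [q] := @rat_in_itvoo _ s (s + e) (ltac:(lra)).
rewrite in_itv/= => /andP[q1 q2].
have iso a : (D `&` I (p, q)) a -> a = s.
  move=> [Da]; rewrite /I/= in_itv/= => /andP[pa aq]; apply/eqP/negPn/negP => as_.
  apply: (De (a - s)); rewrite ?subrK//; last by rewrite subr_eq0.
  by rewrite /ball/= sub0r normrN ltr_norml; apply/andP; split; lra.
exists (p, q) => //; split; first by move=> a b /iso -> /iso ->.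
by split => //; rewrite /I/= in_itv/= p2 q1.
Qed.

(** The measure is built one coordinate at a time, so the proof by induction
    peels off the first coordinate: if it is not the [j]th, slice along it and
    use the induction hypothesis on the slices; if it is, exchange the order of
    integration so that the slices become the lines themselves. *)
Lemma lebesgue_Rn_countable_lines (R : realType) (n : nat) (j : 'I_n)
    (A : set 'rV[R]_n) :
  measurable (A : set (borelRn R n)) ->
  (forall v, countable [set s | A (v + s *: delta_mx ord0 j)]) ->
  lebesgue_Rn R n A = 0%E.
Proof.
elim: n j A => [[]//|n IHn] j A mA cA.
pose B : set (measurableTypeR R * borelRn R n) := consRn @^-1` A.
have mB : measurable B.
  by rewrite -[X in measurable X]setTI; exact: measurable_consRn.
have consE (x : R) (v : 'rV[R]_n) (k : 'I_n.+1) :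
    (consRn (x, v) : 'rV[R]_n.+1) ord0 k =
    if unlift ord0 k is Some i then v ord0 i else x.
  by case: unliftP => [i ->|->]; rewrite ?consRnS ?consRn0.
have cons_lift x (v : 'rV[R]_n) s i :
    (consRn (x, v + s *: delta_mx ord0 i) : 'rV[R]_n.+1) =
    (consRn (x, v) : 'rV[R]_n.+1) + s *: delta_mx ord0 (lift ord0 i).
  apply/rowP => k; rewrite consE [RHS]mxE consE; case: unliftP => [l ->|->].
    by rewrite !mxE (inj_eq (@lift_inj _ _)).
  by rewrite !mxE/= mulr0 addr0.
have cons_0 x (v : 'rV[R]_n) : (consRn (x, v) : 'rV[R]_n.+1) =
    (consRn (0, v) : 'rV[R]_n.+1) + x *: delta_mx ord0 ord0.
  apply/rowP => k; rewrite consE [RHS]mxE consE; case: unliftP => [l ->|->].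
    by rewrite !mxE/= mulr0 addr0.
  by rewrite !mxE/= mulr1 add0r.
(* The measure of [A] is by definition the product measure of [B]. *)
change ((lebesgue_measure \x lebesgue_Rn R n)%E B = 0%E).
have [j' jE|j0] := unliftP ord0 j.
  rewrite /product_measure1; apply: integral0_eq => x _ /=.
  apply: (IHn j'); first exact: measurable_xsection.
  move=> v; have := cA (consRn (x, v)); apply: sub_countable.
  apply: subset_card_le => s /=.
  by rewrite /xsection/= inE /B/= cons_lift jE.
have := @indic_fubini_tonelli _ _ _ _ R lebesgue_measure (lebesgue_Rn R n) B mB.
rewrite -indic_fubini_tonelli1// -indic_fubini_tonelli2//.
rewrite !integral_indic// !setIT => ->.
rewrite /product_measure2; apply: integral0_eq => v _ /=.
apply: countable_lebesgue_measure0.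
have := cA (consRn (0, v)); apply: sub_countable.
apply: subset_card_le => x /=.
by rewrite /ysection/= inE /B/= cons_0 j0.
Qed.

(** A nonzero partial derivative forces the value [t] to be taken at isolated
    points along the corresponding axis. *)
Lemma lebesgue_Rn_level_set (R : realType) (n : nat) (j : 'I_n)
    (f : 'rV[R]_n -> R) (t : R) (A : set 'rV[R]_n) :
  measurable (A : set (borelRn R n)) ->
  (forall x, A x -> [/\ f x = t, derivable f x (delta_mx ord0 j) &
     'D_(delta_mx ord0 j) f x != 0]) ->
  lebesgue_Rn R n A = 0%E.
Proof.
move=> mA Af; apply: (lebesgue_Rn_countable_lines _ _ j) => // v.
apply: countable_isolated => s /= As.
have [fs df d0] := Af _ As.
have := @cvgr_neq0 _ R^o _ _ _ _ _ df d0 => /(_ _); apply: filterS => h /= + Ah.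
have [fhs _ _] := Af _ Ah.
by rewrite fs addrCA -scalerDl fhs subrr scaler0 eqxx.
Qed.

(** * Ties between two costs *)

Lemma measurable_fun_open_continuous (R : realType) (n : nat)
    (U : set 'rV[R]_n) (f : 'rV[R]_n -> R) :
  open U -> (forall x, U x -> {for x, continuous f}) ->
  measurable_fun (U : set (borelRn R n)) (f : borelRn R n -> R).
Proof.
move=> oU cf; apply: (measurability _ (RGenOpens.measurableE R)).
move=> _ [_ [a [b ->]] <-]; apply: open_measurable_Rn.
rewrite openE => x [Ux fx]; rewrite /interior.
apply: filterI; first exact: open_nbhs_nbhs.
apply: (cf x Ux); apply: open_nbhs_nbhs; split => //; exact: interval_open.
Qed.

Lemma C2_near_measurable (R : realType) (n : nat) (X : set 'rV[R]_n)
    (f : 'rV[R]_n -> R) :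
  measurable (X : set (borelRn R n)) -> C2_near X f ->
  measurable_fun (X : set (borelRn R n)) (f : borelRn R n -> R).
Proof.
move=> mX [U [oU XU] [C1f _]]; apply: (measurable_funS (E := U : set (borelRn R n))) => //.
  exact: open_measurable_Rn.
apply: measurable_fun_open_continuous => // x Ux.
by apply: differentiable_continuous; case: (C1f x Ux).
Qed.

Lemma C2_near_measurable_gradient (R : realType) (n : nat) (X : set 'rV[R]_n)
    (f : 'rV[R]_n -> R) (j : 'I_n) :
  measurable (X : set (borelRn R n)) -> C2_near X f ->
  measurable_fun (X : set (borelRn R n))
    (fun x : borelRn R n => gradient f x ord0 j).
Proof.
move=> mX [U [oU XU] [_ /(_ j) C1g]]; apply: (measurable_funS (E := U : set (borelRn R n))) => //.
  exact: open_measurable_Rn.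
apply: measurable_fun_open_continuous => // x Ux.
by apply: differentiable_continuous; case: (C1g x Ux).
Qed.

Lemma C2_near_derivable (R : realType) (n : nat) (X : set 'rV[R]_n)
    (f : 'rV[R]_n -> R) x v :
  C2_near X f -> X x -> derivable f x v.
Proof.
move=> [U [oU XU] [C1f _]] /XU Ux.
by apply: diff_derivable; case: (C1f x Ux).
Qed.

(** Different gradients differ in some component, so the tie set is a finite
    union of pieces on which a fixed partial derivative of [f - g] is nonzero. *)
Lemma tie_set_null (R : realType) (n : nat) (X : set 'rV[R]_n)
    (f g : 'rV[R]_n -> R) (t : R) :
  measurable (X : set (borelRn R n)) -> C2_near X f -> C2_near X g ->
  (forall x, X x -> gradient f x <> gradient g x) ->
  (lebesgue_Rn R n).-negligible
    ([set x | X x /\ f x - g x = t] : set (borelRn R n)).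
Proof.
move=> mX C2f C2g fg.
pose Z j : set 'rV[R]_n := [set x | [/\ X x, f x - g x = t &
  gradient f x ord0 j - gradient g x ord0 j != 0]].
have mZ j : measurable (Z j : set (borelRn R n)).
  have mfg := measurable_funB (C2_near_measurable _ _ _ _ mX C2f)
    (C2_near_measurable _ _ _ _ mX C2g).
  have mdfg := measurable_funB (C2_near_measurable_gradient _ _ _ _ j mX C2f)
    (C2_near_measurable_gradient _ _ _ _ j mX C2g).
  rewrite (_ : Z j = (X `&` (f \- g) @^-1` [set t]) `&`
     (X `&` (fun x => gradient f x ord0 j - gradient g x ord0 j) @^-1` ~` [set 0])).
    apply: measurableI; first exact: mfg.
    by apply: mdfg => //; exact: measurableC.
  apply/seteqP; split => [x [Xx ft /eqP d0]//|x [[Xx ft] [_ /eqP d0]]]; by split.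
apply: (@negligibleS _ (borelRn R n) _ _ (\bigcup_(j in [set: 'I_n]) Z j)).
  move=> x [Xx ft]; apply: contrapT => noZ; apply: (fg x Xx).
  apply/rowP => j; apply/eqP; rewrite -subr_eq0; apply/negPn/negP => d0.
  by apply: noZ; exists j.
have Z0 j : lebesgue_Rn R n (Z j) = 0%E.
  apply: (@lebesgue_Rn_level_set _ _ j (f - g) t) => // x [Xx ft d0].
  have df := @C2_near_derivable _ _ _ _ _ (delta_mx ord0 j) C2f Xx.
  have dg := @C2_near_derivable _ _ _ _ _ (delta_mx ord0 j) C2g Xx.
  split => //; first exact: derivableB.
  by rewrite deriveB//; move: d0; rewrite !mxE.
rewrite -(_ : [set` index_enum 'I_n] = [set: 'I_n]); last first.
  by apply/seteqP; split => // j _; exact: mem_index_enum.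
rewrite bigcup_seq; elim/big_ind: _ => [|A B|j _].
- exact: (@negligible_set0 _ (borelRn R n)).
- exact: (@negligibleU _ (borelRn R n)).
- by apply/negligibleP; [exact: mZ|exact: Z0].
Qed.

(** * Laguerre cells *)

Lemma le_measure_negligible {d} {T : measurableType d} {R : realType}
    (mu : {measure set T -> \bar R}) (A B N : set T) :
  measurable A -> measurable B -> mu.-negligible N -> A `<=` B `|` N ->
  (mu A <= mu B)%E.
Proof.
move=> mA mB [N' [mN' N'0 NN']] AB.
rewrite -(@measureU0 _ _ _ mu B N')//; apply: le_measure; rewrite ?inE//.
  exact: measurableU.
by apply: (subset_trans AB); exact: setUS.
Qed.

Lemma measure_bigsetU_le {d} {T : measurableType d} {R : realType} {I : finType}
    (mu : {measure set T -> \bar R}) (P : pred I) (F : I -> set T) :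
  (forall i, measurable (F i)) ->
  (mu (\big[setU/set0]_(i | P i) F i) <= \sum_(i | P i) mu (F i))%E.
Proof.
move=> mF; suff [] : measurable (\big[setU/set0]_(i | P i) F i) /\
  (mu (\big[setU/set0]_(i | P i) F i) <= \sum_(i | P i) mu (F i))%E by [].
elim/big_rec2: _ => [|i a A _ [mA Aa]]; first by rewrite measure0.
split; first exact: measurableU.
by apply: (le_trans (measureU2 mu (mF i) mA)); exact: leeD.
Qed.

Section transport.
Context {R : realType} {n N : nat}.
Context {mu : probability (borelRn R n) R} {X : set 'rV[R]_n}.
Context {c : 'rV[R]_n -> 'rV[R]_n -> R} {y : 'I_N -> 'rV[R]_n}.
Implicit Types (psi lambda : 'rV[R]_N).

Local Notation score psi x i := (- c x (y i) - psi ord0 i).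
Local Notation phi psi := (cost_transform c y psi).
Local Notation Lag psi i := (laguerre X c y psi i : set (borelRn R n)).

Lemma cost_transform_max psi x : (0 < N)%N ->
  (forall i, score psi x i <= phi psi x) /\ exists i, score psi x i = phi psi x.
Proof.
move=> N0; have [m _ maxm] := @arg_maxP _ _ _ (Ordinal N0) xpredT (fun i => score psi x i) isT.
have ub : ubound (range (fun i => score psi x i)) (score psi x m).
  by move=> _ [i _ <-]; exact: maxm.
have phiE : score psi x m = phi psi x.
  apply/eqP; rewrite eq_le; apply/andP; split.
    by apply: ub_le_sup; [exists (score psi x m)|exists m].
  by apply: ge_sup => //; exists (score psi x m), m.
by split; [move=> i; rewrite -phiE; exact: maxm|exists m].
Qed.

Definition ties psi : set (borelRn R n) :=
  [set x | X x /\ exists i j, i != j /\ score psi x i = score psi x j].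

Lemma ties_negligible psi :
  measurable (X : set (borelRn R n)) -> mu `<< lebesgue_Rn R n ->
  (forall i, C2_near X (fun x => c x (y i))) ->
  (forall x i k, X x -> i != k ->
     gradient (fun x' => c x' (y i)) x <> gradient (fun x' => c x' (y k)) x) ->
  mu.-negligible (ties psi).
Proof.
move=> mX /null_content_dominatesP ac C2c twist.
pose Z (p : 'I_N * 'I_N) : set (borelRn R n) := [set x | X x /\
  c x (y p.1) - c x (y p.2) = psi ord0 p.2 - psi ord0 p.1].
apply: (@negligibleS _ _ _ _ (\big[setU/set0]_(p | p.1 != p.2) Z p)).
  move=> x [Xx [i [j [ij sij]]]].
  rewrite -bigcup_seq_cond; exists (i, j); first by rewrite /= mem_index_enum.
  by split => //=; lra.
elim/big_ind: _ => [|A B|[i j] /= ij].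
- exact: negligible_set0.
- exact: negligibleU.
- have [M [mM M0 ZM]] := @tie_set_null _ _ _ _ _ (psi ord0 j - psi ord0 i)
    mX (C2c i) (C2c j) (fun x Xx => twist x i j Xx ij).
  by exists M; split => //; exact: ac.
Qed.

(** * Mass of the cells of an optimal dual vector *)

Section fixed_target.
Context {lambda psi : 'rV[R]_N}.
Hypothesis N_gt0 : (0 < N)%N.
Hypothesis mX : measurable (X : set (borelRn R n)).
Hypothesis mc : forall i, measurable_fun (X : set (borelRn R n))
  (fun x : borelRn R n => c x (y i) : R).
Hypothesis opt : optimal_dual_vector mu X c y lambda psi.

Let int_phi : mu.-integrable (X : set (borelRn R n)) (EFin \o phi psi).
Proof. by case: opt => -[]. Qed.

Let mphi : measurable_fun (X : set (borelRn R n)) (phi psi : borelRn R n -> R).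
Proof. by apply/measurable_EFinP; exact: measurable_int int_phi. Qed.

Let mscore i : measurable_fun (X : set (borelRn R n))
  (fun x : borelRn R n => score psi x i).
Proof. by apply: measurable_funB => //; exact: measurableT_comp. Qed.

Lemma measurable_laguerre i : measurable (Lag psi i).
Proof.
rewrite (_ : Lag psi i = (X : set (borelRn R n)) `&`
    [set x | phi psi x <= score psi x i]); last first.
  apply/seteqP; split => x [Xx]; first by move=> e; split => //=; rewrite e.
  move=> /= le; split => //; apply/eqP.
  by rewrite eq_le le andbT; case: (@cost_transform_max psi x N_gt0).
exact: measurable_fun_le.
Qed.

(** For [t > 0] only [i] can attain the maximum here: this is the part of the
    [i]th cell that survives raising [psi ord0 i] by [t]. *)
Definition margin_set i (t : R) : set (borelRn R n) :=
  [set x | X x /\ forall j, j != i -> score psi x j + t <= phi psi x].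

Lemma measurable_margin_set i t : measurable (margin_set i t).
Proof.
rewrite (_ : margin_set i t = X `&` \bigcap_(j in [set j | j != i])
    (X `&` [set x | score psi x j + t <= phi psi x])).
  apply: measurableI => //; apply: fin_bigcap_measurable => [|j _].
    exact: finite_finset.
  by apply: measurable_fun_le => //; exact: measurable_funD.
apply/seteqP; split=> [x [Xx ti]|x [Xx ti]]; split => // j /ti //.
by case.
Qed.

(** First-order optimality in the direction of the [i]th coordinate.  The
    competing potential is [cost_transform psi - t] on the margin set and
    [cost_transform psi] elsewhere, rather than the transform of the perturbed
    vector: admissibility is then immediate and the integral explicit. *)
Lemma margin_set_le i t : 0 < t -> (mu (margin_set i t) <= (lambda ord0 i)%:E)%E.
Proof.
move=> t0; pose G := margin_set i t; have mG : measurable G.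
  exact: measurable_margin_set.
have int_G : mu.-integrable (X : set (borelRn R n)) (fun x => (\1_G x)%:E : \bar R).
  by apply: (integrableS measurableT) => //; exact: integrable_indic.
have int_tG : mu.-integrable (X : set (borelRn R n)) (EFin \o (fun x => t * \1_G x)).
  by apply: integrableZl int_G.
pose phi' x := phi psi x - t * \1_G x.
pose psi' : 'rV[R]_N := psi + t *: delta_mx ord0 i.
have psi'E j : psi' ord0 j = psi ord0 j + t * (j == i)%:R by rewrite !mxE eqxx.
have adm : dual_admissible mu X c y phi' psi'.
  split.
    by apply: (integrableB mX int_phi int_tG).
  (* For [j = i] the increase of [psi] compensates the decrease of the
     potential; for [j != i] the decrease happens only within the margin. *)
  apply: aeW => x Xx j; rewrite psi'E /phi' indicE.
  have := (@cost_transform_max psi x N_gt0).1 j.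
  case: (eqVneq j i) => [->|ji].
    by case: (_ \in _) => /= h; lra.
  case: (boolP (x \in G)) => [/set_mem[_ /(_ _ ji) /=]|_] /=; lra.
have := opt.2 _ _ adm; rewrite /dual_value.
rewrite RintegralB// RintegralZl//.
have -> : (\int[mu]_(x in (X : set (borelRn R n))) \1_G x)%R = fine (mu G).
  rewrite /Rintegral integral_indic//; congr (fine (mu _)).
  by apply/setIidl => x [].
have -> : \sum_(k < N) psi' ord0 k * lambda ord0 k =
    \sum_(k < N) psi ord0 k * lambda ord0 k + t * lambda ord0 i.
  under eq_bigr do rewrite psi'E mulrDl.
  rewrite big_split/= [X in _ + X](bigD1 i)//= eqxx mulr1 [X in _ + (_ + X)]big1 ?addr0// => k /negPf ->.
  by rewrite mulr0 mul0r.
move=> h; have muG : mu G \is a fin_num by exact: fin_num_measure.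
rewrite -/G -(fineK muG) lee_fin -(ler_pM2l t0); lra.
Qed.

(** Off the ties, the cell is the increasing union of its margin sets as the
    margin tends to 0. *)
Lemma laguerre_le i : mu.-negligible (ties psi) ->
  (mu (Lag psi i) <= (lambda ord0 i)%:E)%E.
Proof.
move=> ties0; pose G k := margin_set i k.+1%:R^-1.
have mG k : measurable (G k) by exact: measurable_margin_set.
have mUG : measurable (\bigcup_k G k) by exact: bigcupT_measurable.
apply: (@le_trans _ _ (mu (\bigcup_k G k))).
  apply: (le_measure_negligible _ _ _ _ _ _ ties0) => //.
    exact: measurable_laguerre.
  move=> x [Xx Lx]; have [tx|ntx] := pselect (ties psi x); [by right|left].
  have gap j : j != i -> 0 < phi psi x - score psi x j.
    move=> ji; rewrite subr_gt0 lt_neqAle.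
    rewrite (@cost_transform_max psi x N_gt0).1 andbT; apply/eqP => e.
    by apply: ntx; split => //; exists j, i; split => //; rewrite e Lx.
  have : \forall k \near \oo, forall j, j != i ->
      score psi x j + k.+1%:R^-1 <= phi psi x.
    apply: filter_forall => j; have [ji|ji] := eqVneq j i.
      by apply: nearW.
    have := near_infty_natSinv_lt (PosNum (gap j ji)); apply: filterS => k /= kj _.
    by rewrite -lerBrDl ltW.
  by move=> /filter_ex[k Gk]; exists k.
have ndG : nondecreasing_seq G.
  move=> k l kl; apply/subsetPset => x [Xx Gx]; split => // j /Gx; apply: le_trans.
  by rewrite lerD2l lef_pV2 ?posrE// ler_nat ltnS.
apply: cvge_le (nondecreasing_cvg_mu mG mUG ndG).
by apply: nearW => k /=; exact: margin_set_le.
Qed.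

End fixed_target.

(** * Comparison of two dual vectors *)

(** Add the inequality saying that [i] beats [j] for [psi1], strict off the
    ties, to the one saying that [j] beats [i] for [psi2]: the costs cancel. *)
Lemma laguerre_trade psi1 psi2 x i j :
  i != j -> ~ ties psi1 x -> Lag psi1 i x -> Lag psi2 j x ->
  psi1 ord0 i - psi2 ord0 i < psi1 ord0 j - psi2 ord0 j.
Proof.
move=> ij notie [Xx L1] [_ L2].
have N0 : (0 < N)%N := leq_ltn_trans (leq0n i) (ltn_ord i).
have := (@cost_transform_max psi1 x N0).1 j.
have := (@cost_transform_max psi2 x N0).1 i.
rewrite -L1 -L2 => h2; rewrite le_eqVlt => /orP[/eqP s1|]; last by lra.
by exfalso; apply: notie; split => //; exists j, i; rewrite eq_sym.
Qed.

(** The bound is a cut argument: mass moves only towards larger values of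
    [psi1 - psi2], so what leaves the [k]th cell crosses the cut at the level of
    [k], and the net flow through the cut is a partial sum of
    [lambda1 - lambda2]. *)
Lemma laguerre_setD_le lambda1 lambda2 psi1 psi2 k :
  (0 < N)%N -> mu (~` X) = 0%E ->
  simplex lambda1 -> simplex lambda2 ->
  measurable (X : set (borelRn R n)) ->
  mu.-negligible (ties psi1) ->
  (forall i, measurable (Lag psi1 i)) -> (forall i, measurable (Lag psi2 i)) ->
  (forall i, mu (Lag psi1 i) <= (lambda1 ord0 i)%:E)%E ->
  (forall i, mu (Lag psi2 i) <= (lambda2 ord0 i)%:E)%E ->
  (mu (Lag psi1 k `\` Lag psi2 k) <= (l1norm (lambda1 - lambda2))%:E)%E.
Proof.
move=> N0 muX [_ sum1] [_ sum2] mX ties0 mL1 mL2 le1 le2.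
pose S i := psi1 ord0 i - psi2 ord0 i <= psi1 ord0 k - psi2 ord0 k.
pose A : set (borelRn R n) := \big[setU/set0]_(i | S i) Lag psi1 i.
pose C : set (borelRn R n) := \big[setU/set0]_(i | ~~ S i) Lag psi2 i.
have mA : measurable A by exact: bigsetU_measurable.
have mC : measurable C by exact: bigsetU_measurable.
have inA x i : S i -> Lag psi1 i x -> A x.
  move=> Si Lx; rewrite /A -bigcup_seq_cond; exists i => //=.
  by rewrite mem_index_enum.
have inC x i : ~~ S i -> Lag psi2 i x -> C x.
  move=> Si Lx; rewrite /C -bigcup_seq_cond; exists i => //=.
  by rewrite mem_index_enum.
have muA : (mu A <= (\sum_(i | S i) lambda1 ord0 i)%:E)%E.
  rewrite -sumEFin; apply: (le_trans (measure_bigsetU_le _ _ _ mL1)).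
  by apply: lee_sum => i _; exact: le1.
have muC : (mu C <= (\sum_(i | ~~ S i) lambda2 ord0 i)%:E)%E.
  rewrite -sumEFin; apply: (le_trans (measure_bigsetU_le _ _ _ mL2)).
  by apply: lee_sum => i _; exact: le2.
have nullX : mu.-negligible (~` X `|` ties psi1).
  apply: negligibleU => //; apply/negligibleP => //; exact: measurableC.
(* The two unions cover [X]: a point whose [psi2]-cell lies below the cut came
   from a [psi1]-cell that lies below it too. *)
have muAC : (1%:E <= mu (A `|` C))%E.
  rewrite -(@probability_setT _ _ _ mu).
  apply: (le_measure_negligible _ _ _ _ _ _ nullX) => //; first exact: measurableU.
  move=> x _; have [Xx|] := pselect (X x); last by right; left.
  have [tx|ntx] := pselect (ties psi1 x); [by right; right|left].
  have [_ [i Li]] := @cost_transform_max psi1 x N0.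
  have [_ [j Lj]] := @cost_transform_max psi2 x N0.
  have [Sj|Sj] := boolP (S j); last by right; apply: (inC _ j).
  left; apply: (inA _ i) => //; have [-> //|ij] := eqVneq i j.
  apply: le_trans Sj; apply: ltW.
  exact: (laguerre_trade _ _ _ _ _ ij ntx (conj Xx Li) (conj Xx Lj)).
have : (mu (Lag psi1 k `\` Lag psi2 k) <= mu (A `&` C))%E.
  apply: (le_measure_negligible _ _ _ _ _ _ nullX).
  - exact: measurableD.
  - exact: measurableI.
  move=> x [L1 nL2]; have [tx|ntx] := pselect (ties psi1 x); first by right; right.
  left; split; first by apply: (inA _ k) => //; rewrite /S.
  have [_ [j Lj]] := @cost_transform_max psi2 x N0.
  have L2 : Lag psi2 j x by split => //; case: L1.
  have kj : k != j by apply/eqP => kj; apply: nL2; rewrite kj.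
  apply: (inC _ j) => //; rewrite /S -ltNge.
  exact: (laguerre_trade _ _ _ _ _ kj ntx L1 L2).
move=> /le_trans; apply.
have finA := fin_num_measure mu A mA; have finC := fin_num_measure mu C mC.
have mAC : measurable (A `&` C) by exact: measurableI.
have finAC := fin_num_measure mu _ mAC.
have muACE : mu (A `|` C) = (mu A + mu C - mu (A `&` C))%E.
  by apply: measureUfinr => //; rewrite -ge0_fin_numE.
move: muAC muA muC; rewrite muACE.
rewrite -(fineK finA) -(fineK finC) -(fineK finAC) -!EFinD !lee_fin.
move=> h1 h2 h3.
have : 1 = \sum_(i | S i) lambda2 ord0 i + \sum_(i | ~~ S i) lambda2 ord0 i.
  by rewrite -sum2 (bigID S).
have : \sum_(i | S i) (lambda1 ord0 i - lambda2 ord0 i) <= l1norm (lambda1 - lambda2).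
  apply: (@le_trans _ _ (\sum_(i | S i) `|(lambda1 - lambda2) ord0 i|)).
    by apply: ler_sum => i _; rewrite !mxE; exact: ler_norm.
  rewrite /l1norm [leRHS](bigID S)/= lerDl; exact: sumr_ge0.
by rewrite sumrB; lra.
Qed.

End transport.

(** * Stability of the cells *)

Theorem theorem1p3 (R : realType) (n N : nat) (hn : (2 <= n)%N) (hN : (1 <= N)%N)
    (X : set 'rV[R]_n) (hX : compact X)
    (y : 'I_N -> 'rV[R]_n) (hy : injective y)
    (c : 'rV[R]_n -> 'rV[R]_n -> R) (hc : borel_cost X c y)
    (mu : probability (borelRn R n) R)
    (hmu_ac : mu `<< lebesgue_Rn R n) (hmu_X : mu (~` X) = 0%E)
    (hc_C2 : forall i, C2_near X (fun x => c x (y i)))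
    (hc_twist : forall x i k, X x -> i != k ->
       gradient (fun x' => c x' (y i)) x <> gradient (fun x' => c x' (y k)) x)
    (lambda1 lambda2 psi1 psi2 : 'rV[R]_N)
    (hlambda1 : simplex lambda1) (hlambda2 : simplex lambda2)
    (hpsi1 : optimal_dual_vector mu X c y lambda1 psi1)
    (hpsi2 : optimal_dual_vector mu X c y lambda2 psi2) :
  (\sum_(i < N) sym_diff_measure mu (laguerre X c y psi1 i) (laguerre X c y psi2 i)
    <= (4 * N%:R * l1norm (lambda1 - lambda2))%:E)%E.
Proof.
have mX : measurable (X : set (borelRn R n)).
  have cX : closed X by apply: compact_closed => //; exact: norm_hausdorff.
  rewrite -[X in measurable X]setCK; apply: measurableC.
  by apply: open_measurable_Rn; exact: closed_openC.
have mc i := C2_near_measurable _ _ _ _ mX (hc_C2 i).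
have t1 := ties_negligible psi1 mX hmu_ac hc_C2 hc_twist.
have t2 := ties_negligible psi2 mX hmu_ac hc_C2 hc_twist.
have mL1 := measurable_laguerre hN mX mc hpsi1.
have mL2 := measurable_laguerre hN mX mc hpsi2.
have le1 i := laguerre_le hN mX mc hpsi1 i t1.
have le2 i := laguerre_le hN mX mc hpsi2 i t2.
have l1C : l1norm (lambda2 - lambda1) = l1norm (lambda1 - lambda2).
  by apply: eq_bigr => i _; rewrite !mxE distrC.
set e := l1norm (lambda1 - lambda2).
have e0 : 0 <= e by exact: sumr_ge0.
apply: (@le_trans _ _ (\sum_(i < N) (e + e)%:E)%E).
  apply: lee_sum => i _; rewrite /sym_diff_measure EFinD.
  apply: (le_trans (measureU2 mu _ _)); try exact: measurableD.
  apply: leeD; first exact: (laguerre_setD_le lambda1 lambda2).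
  by rewrite -[e]l1C; exact: (laguerre_setD_le lambda2 lambda1).
rewrite sumEFin lee_fin sumr_const card_ord -[leLHS]mulr_natr.
have : 0 <= e * N%:R by rewrite mulr_ge0.
by lra.
Qed.
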